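(* Let $\Gamma$ be a countable group with a splitting $\Gamma=A\ast B$ into two non-trivial groups, such that $A$ contains an element of infinite order. For $1<p<\infty$ the split classes form an infinite-dimensional subspace of $\mathrm{H}^2_\mathrm{b}(\Gamma,\ell^p(\Gamma))$. If moreover $A$ is amenable, the same holds for $p=1$.
   Context: $\ell^p(\Gamma)$ carries the left-regular action $(g.\chi)(h)=\chi(g^{-1}h)$. For a Banach $\Gamma$-module $E$ (Banach space with linear isometric $\Gamma$-action), a quasicocycle is a map $f:\Gamma\to E$ with $\sup_{g,h}\|f(gh)-f(g)-g.f(h)\|<\infty$; it is alternating if $f(g)+g.f(g^{-1})=0$ for all $g$. $\mathrm{H}^*_\mathrm{b}(\Gamma,E)$ is the cohomology of the bounded bar complex; for a quasicocycle $f$, $\omega_f:=[\partial f]_\mathrm{b}\in\mathrm{H}^2_\mathrm{b}(\Gamma,E)$ where $\partial f(g,h)=f(g)+g.f(h)-f(gh)$. Each $1\neq g\in A\ast B$ has a unique normal form $g=a_1b_1\cdots a_nb_n$ ($a_i\in A$, $b_i\in B$, all non-trivial except possibly $a_1$ or $b_n$). For alternating quasicocycles $f_A:A\to E$, $f_B:B\to E$ the split quasicocycle is $(f_A\ast f_B)(1)=0$, $(f_A\ast f_B)(a_1b_1\cdots a_nb_n)=f_A(a_1)+a_1.f_B(b_1)+a_1b_1.f_A(a_2)+\dots+a_1b_1\cdots b_{n-1}a_n.f_B(b_n)$. The split classes are the classes $\omega_{f_A\ast f_B}$, i.e. the image of the linear map $(f_A,f_B)\mapsto\omega_{f_A\ast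 f_B}$. *)

(* Defs.v *)
From HB Require Import structures.
From mathcomp Require Import all_boot all_order all_algebra.
From mathcomp Require Import classical_sets reals ereal esum exp.
Set Implicit Arguments. Unset Strict Implicit. Unset Printing Implicit Defensive.
Import Order.TTheory GRing.Theory Num.Theory.
Local Open Scope ring_scope.

Record group_on (G : Type) := GroupOn {
  gmul : G -> G -> G;
  gone : G;
  ginv : G -> G;
  gmulA : forall x y z, gmul x (gmul y z) = gmul (gmul x y) z;
  gmul1 : forall x, gmul gone x = x;
  gmulV : forall x, gmul (ginv x) x = gone
}.

Section Defs.
Variable G : countType.
Variable grp : group_on G.
Local Notation gm := (gmul grp).
Local Notation e := (gone grp).
Local Notation "x ^-1" := (ginv grp x).

Definition subgroup (A : G -> Prop) :=
  [/\ A e, (forall x y, A x -> A y -> A (gm x y)) & (forall x, A x -> A (x^-1))].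

Fixpoint gpow (x : G) (n : nat) : G :=
  if n is n'.+1 then gm x (gpow x n') else e.

(* Words over A and B: letters tagged true (from A) or false (from B). *)
Definition wprod (s : seq (bool * G)) : G := foldr (fun u acc => gm u.2 acc) e s.

Fixpoint alternating_tags (s : seq bool) : Prop :=
  match s with
  | b :: ((c :: _) as s') => b <> c /\ alternating_tags s'
  | _ => True
  end.

Definition reduced (A B : G -> Prop) (s : seq (bool * G)) : Prop :=
  (forall u, u \in s -> u.2 <> e /\ (if u.1 then A u.2 else B u.2))
  /\ alternating_tags (map fst s).

Definition free_product (A B : G -> Prop) : Prop :=
  forall g, exists s, reduced A B s /\ wprod s = g /\
    forall t, reduced A B t -> wprod t = g -> t = s.

Definition amenable_sub (R : realType) (A : G -> Prop) : Prop :=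
  let bdd := fun phi : G -> R => exists M : R, forall a, A a -> `|phi a| <= M in
  exists m : (G -> R) -> R,
    (forall phi psi, bdd phi -> bdd psi -> m (fun x => phi x + psi x) = m phi + m psi) /\
    (forall c phi, bdd phi -> m (fun x => c * phi x) = c * m phi) /\
    (forall phi, bdd phi -> (forall a, A a -> 0 <= phi a) -> 0 <= m phi) /\
    m (fun _ => 1) = 1 /\
    (forall phi psi, bdd phi -> (forall a, A a -> phi a = psi a) -> m phi = m psi) /\
    (forall a phi, A a -> bdd phi -> m (fun x => phi (gm (a^-1) x)) = m phi).

Section lp.
Variable R : realType.
Variable p : R.

Definition lpsum (v : G -> R) : \bar R := \esum_(x in setT) ((powR `|v x| p)%:E).
Definition in_lp (v : G -> R) : Prop := (lpsum v < +oo)%E.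

Definition lact (g : G) (v : G -> R) : G -> R := fun h => v (gm (g^-1) h).

Definition dcob (f : G -> G -> R) (g h : G) : G -> R :=
  fun x => f g x + lact g (f h) x - f (gm g h) x.

(* bounded: sup norm finite (expressed via ||.||_p^p) *)
Definition bounded_lp1 (D : G -> Prop) (f : G -> G -> R) : Prop :=
  (forall g, D g -> in_lp (f g)) /\
  exists M : R, forall g, D g -> (lpsum (f g) <= M%:E)%E.

Definition alt_quasicocycle (D : G -> Prop) (f : G -> G -> R) : Prop :=
  [/\ forall g, D g -> in_lp (f g),
      exists M : R, forall g h, D g -> D h -> (lpsum (dcob f g h) <= M%:E)%E
    & forall g, D g -> forall x, f g x + lact g (f (g^-1)) x = 0].

Fixpoint splitw (fA fB : G -> G -> R) (s : seq (bool * G)) : G -> R :=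
  match s with
  | [::] => fun _ => 0
  | u :: s' => fun x => (if u.1 then fA u.2 else fB u.2) x + lact u.2 (splitw fA fB s') x
  end.

Definition is_split (A B : G -> Prop) (fA fB F : G -> G -> R) : Prop :=
  forall s, reduced A B s -> F (wprod s) = splitw fA fB s.

Definition trivial_class (c : G -> G -> G -> R) : Prop :=
  exists beta : G -> G -> R, bounded_lp1 (fun _ => True) beta /\
    forall g h x, c g h x = dcob beta g h x.

(* The split classes span an infinite-dimensional subspace of H^2_b(G, l^p(G)):
   for every n there are n split classes that are linearly independent. *)
Definition split_classes_infinite_dim (A B : G -> Prop) : Prop :=
  forall n : nat, exists fA fB F : 'I_n -> G -> G -> R,
    (forall i, [/\ alt_quasicocycle A (fA i), alt_quasicocycle B (fB i)
                 & is_split A B (fA i) (fB i) (F i)]) /\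
    forall c : 'I_n -> R,
      trivial_class (fun g h x => \sum_(i < n) c i * dcob (F i) g h x) ->
      forall i, c i = 0.
End lp.
End Defs.

(* Main.v *)
Require Import Defs.
From HB Require Import structures.
From mathcomp Require Import all_boot all_order all_algebra lra zify.
From mathcomp Require Import boolp classical_sets cardinality fsbigop filter.
From mathcomp Require Import reals ereal topology normedtype sequences derive.
From mathcomp Require Import esum exp.
Set Implicit Arguments.
Unset Strict Implicit.
Unset Printing Implicit Defensive.
Import Order.TTheory GRing.Theory Num.Theory.
Import numFieldNormedType.Exports.
Local Open Scope classical_set_scope.
Local Open Scope ring_scope.

(* Let [a] in [A] have infinite order and [1 <> b] in [B].  Take [f_B = 0] and
   for [f_A] linear combinations [f] of the functions [f_i], finitely supported
   in the group variable, with [f_i (g) = delta_1 - delta_g] at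
   [g = a^(i+1), a^-(i+1)].  Suppose that the split quasicocycle [F] of [f] has
   the same coboundary as a bounded [beta], so that [F - beta] is a cocycle.
   On the subgroup [<a>] this cocycle is bounded, hence a coboundary, and after
   subtracting a global coboundary [beta] agrees with [F] on [<a>].  For words
   [w = a^k1 b ... a^kn b] with [k_i] large, [F w = 0], so [beta w] is a sum of
   translates of [beta b]; if the [k_i] grow fast these are almost disjoint, and
   boundedness of [beta] forces [beta b = 0].  Now [beta] and [F] agree on all
   products of powers of [a] and of [b], but [F ((a^k b)^n)] takes the value [c_k]
   at [n] distinct points, where [c_k] is the coefficient of [f_(k-1)] in [f];
   hence [c_k = 0].  Since only the amenable group [<a>] matters, the argument is
   uniform in [p > 0]. *)

(** * Limits along ultrafilters *)

Lemma fmap_ultra (U V : Type) (f : U -> V) (F : set_system U) :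
  UltraFilter F -> UltraFilter (f @ F).
Proof.
move=> FU; have PF := ultra_proper; split; first exact: fmap_proper_filter.
move=> H HP sFH; apply/seteqP; split=> A; last exact: sFH.
have [//|nA] := in_ultra_setVsetC (f @^-1` A) FU.
move=> HA; have /filter_ex [x []] : H (A `&` ~` A) by apply: filterI => //; apply: sFH.
by [].
Qed.

(** Compactness of the segment [-C, C], in its ultrafilter form. *)
Lemma bounded_cvg_ultra (R : realType) (F : set_system nat) (u : nat -> R) (C : R) :
  UltraFilter F -> (forall k, `|u k| <= C) -> exists l : R, u @ F --> l.
Proof.
move=> FU uC.
have := segment_compact (a := - C) (b := C); rewrite compact_ultra.
move=> /(_ (u @ F) (fmap_ultra u FU)).
case=> [|l [_ ul]]; last by exists l.
by apply: (@filterE _ F) => k /=; rewrite in_itv/= -ler_norml.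
Qed.

(** * Bounds and limits in l^p *)

Section LpBound.
Context {T : countType} {R : realType} {p : R}.
Hypothesis p_gt0 : 0 < p.
Implicit Types (u v : T -> R) (M : R).

(** [M] bounds the p-th power of the norm. Finite sums over duplicate-free lists keep the estimates
    in [R]. *)
Definition lple v M := forall s : seq T, uniq s -> \sum_(x <- s) `|v x| `^ p <= M.

Lemma lpsum_leP v M : (lpsum p v <= M%:E)%E <-> lple v M.
Proof.
split=> [vM s us|vM].
  rewrite -lee_fin; apply: le_trans vM.
  apply: esum_ge; exists [set` s].
    by split; [exact: finite_seq|].
  by rewrite -fsbig_seq//= sumEFin.
apply: ge_ereal_sup => _ [X [finX _] <-].
rewrite fsbig_finite// sumEFin lee_fin; apply: vM; exact: finmap.fset_uniq.
Qed.

Lemma in_lpP v : in_lp p v <-> exists M, lple v M.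
Proof.
split=> [vfin|[M /lpsum_leP vM]]; last exact: le_lt_trans vM (ltry _).
have v_ge0 : (0 <= lpsum p v)%E.
  by apply: esum_ge0 => x _; rewrite lee_fin powR_ge0.
exists (fine (lpsum p v)); apply/lpsum_leP.
by rewrite fineK // ge0_fin_numE.
Qed.

Lemma lple_ge0 v M : lple v M -> 0 <= M.
Proof. by move=> /(_ [::] isT); rewrite big_nil. Qed.

Lemma lple_eq u v M : u =1 v -> lple u M -> lple v M.
Proof. by move=> uv uM s us; under eq_bigr do rewrite -uv; exact: uM. Qed.

Lemma lple_pointwise v M x : lple v M -> `|v x| `^ p <= M.
Proof. by move=> /(_ [:: x] isT); rewrite big_seq1. Qed.

Lemma lple_le v M M' : M <= M' -> lple v M -> lple v M'.
Proof. by move=> MM' vM s us; apply: le_trans MM'; exact: vM. Qed.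

Lemma lple0 : lple (fun _ => 0) 0.
Proof. by move=> s _; rewrite big1// => x _; rewrite normr0 powR0 ?gt_eqF. Qed.

(* Instead of Minkowski's inequality, the cheap |x + y| <= 2 max(|x|, |y|). *)
Lemma lpleD u v M M' : lple u M -> lple v M' ->
  lple (fun x => u x + v x) (2 `^ p * (M + M')).
Proof.
move=> uM vM s us.
apply: (@le_trans _ _ (\sum_(x <- s) 2 `^ p * (`|u x| `^ p + `|v x| `^ p))).
  apply: ler_sum => x _.
  have le_max (c d : R) : 0 <= c -> c <= d -> (c + d) `^ p <= 2 `^ p * (c `^ p + d `^ p).
    move=> c0 cd; have d0 := le_trans c0 cd.
    apply: (@le_trans _ _ ((2 * d) `^ p)).
      by apply: ge0_ler_powR; rewrite ?nnegrE ?(ltW p_gt0)//; lra.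
    by rewrite powRM// ler_wpM2l ?powR_ge0// lerDr powR_ge0.
  apply: (@le_trans _ _ ((`|u x| + `|v x|) `^ p)).
    by apply: ge0_ler_powR; rewrite ?nnegrE ?(ltW p_gt0) ?addr_ge0 ?ler_normD.
  have [uv|/ltW vu] := lerP `|u x| `|v x|; first exact: le_max.
  by rewrite addrC [X in _ * X]addrC; exact: le_max.
by rewrite -mulr_sumr big_split/= ler_wpM2l ?powR_ge0// lerD ?uM ?vM.
Qed.

Lemma lpleZ c v M : lple v M -> lple (fun x => c * v x) (`|c| `^ p * M).
Proof.
move=> vM s us; under eq_bigr do rewrite normrM powRM//.
by rewrite -mulr_sumr ler_wpM2l ?powR_ge0// vM.
Qed.

Lemma lpleB u v M M' : lple u M -> lple v M' ->
  lple (fun x => u x - v x) (2 `^ p * (M + M')).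
Proof.
move=> uM vM'; apply: lpleD => // s us.
by under eq_bigr do rewrite normrN; exact: vM'.
Qed.

Lemma lple_inj v M (q : T -> T) : injective q -> lple v M ->
  lple (fun x => v (q x)) M.
Proof.
move=> qI vM s us.
by have := vM (map q s); rewrite big_map map_inj_uniq//; apply.
Qed.

Lemma lple_sum (I : Type) (r : seq I) (c : I -> R) (v : I -> T -> R) :
  (forall i, exists M, lple (v i) M) ->
  exists M, lple (fun x => \sum_(i <- r) c i * v i x) M.
Proof.
move=> v_lp; elim: r => [|i r [M rM]].
  by exists 0; apply: lple_eq lple0 => x; rewrite big_nil.
have [M' iM] := v_lp i; eexists.
by apply: lple_eq (lpleD (lpleZ (c i) iM) rM) => x; rewrite big_cons.
Qed.

Lemma lple_delta (y : T) : lple (fun x => (x == y)%:R) 1.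
Proof.
move=> s us.
rewrite (eq_bigr (fun x => (x == y)%:R)); last first.
  by move=> x _; case: eqP; rewrite ?normr1 ?powR1// normr0 powR0 ?gt_eqF.
rewrite -natr_sum (_ : (\sum_(x <- s) (x == y))%N = count_mem y s).
  by rewrite count_uniq_mem// lern1 leq_b1.
by rewrite -sum1_count [RHS]big_mkcond.
Qed.

(** Along [q] the p-th powers have partial sums bounded by [M], so their series converges and its
    terms tend to 0. *)
Lemma lple_near0 v M (q : nat -> T) (eps : R) : injective q -> lple v M ->
  0 < eps -> \forall k \near \oo, `|v (q k)| < eps.
Proof.
move=> qI vM eps0.
have : (fun k => `|v (q k)| `^ p) @ \oo --> (0 : R).
  apply: cvg_series_cvg_0; apply: nondecreasing_is_cvgn.
    apply/nondecreasing_seqP => n.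
    by rewrite /series /= big_nat_recr//= lerDl powR_ge0.
  exists M => _ [n _ <-]; rewrite /series /= /index_iota subn0.
  by have := vM (map q (iota 0 n)); rewrite big_map map_inj_uniq ?iota_uniq//; apply.
move=> /cvgr0Pnorm_lt /(_ (eps `^ p)); rewrite powR_gt0// => /(_ isT).
apply: filterS => k; rewrite ger0_norm ?powR_ge0//.
apply: contraTT; rewrite -!leNgt => le_eps.
by apply: ge0_ler_powR; rewrite ?nnegrE ?(ltW p_gt0)// ltW.
Qed.

Lemma lple_large_size v M (eps : R) (s : seq T) : lple v M -> uniq s ->
  0 <= eps -> {in s, forall x, eps <= `|v x|} -> (size s)%:R * eps `^ p <= M.
Proof.
move=> vM us eps0 large; apply: le_trans (vM s us).
rewrite mulr_natl; elim: s {us} large => [|x s IHs] large; first by rewrite big_nil.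
rewrite big_cons mulrS lerD//; last by apply: IHs => y ys; rewrite large// inE ys orbT.
by apply: ge0_ler_powR; rewrite ?nnegrE ?(ltW p_gt0)// large// mem_head.
Qed.

(** An n above M / eps^p is incompatible with n eps^p <= M. This is the contradiction used against a
    bounded primitive. *)
Lemma lple_no_large (I : Type) (v : I -> T -> R) M (eps : R) : 0 < eps ->
  (forall i, lple (v i) M) ->
  ~ (forall n, exists i s, [/\ uniq s, size s = n & {in s, forall x, eps <= `|v i x|}]).
Proof.
move=> eps0 vM large; set C := M / eps `^ p.
have [i [s [us sz large_s]]] := large (Num.bound C).
have := lple_large_size (vM i) us (ltW eps0) large_s.
rewrite sz -ler_pdivlMr ?powR_gt0// -/C leNgt => /negP; apply.
apply: archi_boundP; rewrite divr_ge0 ?powR_ge0//; exact: lple_ge0 (vM i).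
Qed.

(** The power is differentiable only away from 0, so the limit 0 is treated separately, with
    threshold eps^(1/p). *)
Lemma cvg_norm_powR (F : set_system nat) (u : nat -> R) (l : R) : Filter F ->
  u @ F --> l -> (fun k => `|u k| `^ p) @ F --> `|l| `^ p.
Proof.
move=> FF ul; have [l0|l_neq0] := eqVneq l 0.
  rewrite l0 normr0 powR0 ?gt_eqF//; apply/cvgr0Pnorm_lt => eps eps0.
  move: ul; rewrite l0 => /cvgr0Pnorm_lt /(_ (eps `^ p^-1)).
  rewrite powR_gt0// => /(_ isT); apply: filterS => k ltk.
  rewrite ger0_norm ?powR_ge0//.
  have := gt0_ltr_powR p_gt0 _ _ ltk.
  by rewrite -powRrM mulVf ?gt_eqF// powRr1 ?(ltW eps0)// !nnegrE powR_ge0 normr_ge0; apply.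
apply: (@continuous_cvg _ _ _ _ _ _ (fun x => x `^ p)); last exact: cvg_norm.
apply: differentiable_continuous; apply/derivable1_diffP; apply: derivable_powR.
by rewrite in_itv/= andbT normr_gt0.
Qed.

(** Each finite partial sum passes to the limit, as in Fatou's lemma. *)
Lemma lple_cvg (F : set_system nat) (u : nat -> T -> R) v M : ProperFilter F ->
  (forall k, lple (u k) M) ->
  (forall x, u ^~ x @ F --> v x) -> lple v M.
Proof.
move=> FF uM uv s us.
apply: (cvgr_to_le (f := fun k => \sum_(x <- s) `|u k x| `^ p) (F := F)).
  by apply: cvg_big => [|x _]; [exact: add_continuous|apply: cvg_norm_powR].
by apply: filterE => k; exact: uM.
Qed.

End LpBound.

(** * Group laws and powers of an element of infinite order *)

Section Group.
Context {G : countType} (grp : group_on G).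
Local Notation gm := (gmul grp).
Local Notation e := (gone grp).
Local Notation "x ^-1" := (ginv grp x).

Lemma gmulKl x y : gm (x^-1) (gm x y) = y.
Proof. by rewrite gmulA gmulV gmul1. Qed.

Lemma gmulI x : injective (gm x).
Proof. by move=> y z /(congr1 (gm (x^-1))); rewrite !gmulKl. Qed.

Lemma gmulr1 x : gm x e = x.
Proof. by apply: (@gmulI (x^-1)); rewrite gmulKl gmulV. Qed.

Lemma gmulrV x : gm x (x^-1) = e.
Proof. by apply: (@gmulI (x^-1)); rewrite gmulKl gmulr1. Qed.

Lemma gmulVKl x y : gm x (gm (x^-1) y) = y.
Proof. by rewrite gmulA gmulrV gmul1. Qed.

Lemma ginvM x y : (gm x y)^-1 = gm (y^-1) (x^-1).
Proof. by apply: (@gmulI (gm x y)); rewrite gmulrV -gmulA gmulVKl gmulrV. Qed.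

Lemma ginvK x : (x^-1)^-1 = x.
Proof. by apply: (@gmulI (x^-1)); rewrite gmulrV gmulV. Qed.

Lemma ginv1 : e^-1 = e.
Proof. by rewrite -[LHS](gmul1 grp) gmulrV. Qed.

Lemma ginv_inj : injective (ginv grp).
Proof. by move=> x y xy; rewrite -[x]ginvK xy ginvK. Qed.

Lemma gmulIr x : injective (gm^~ x).
Proof. by move=> y z /(congr1 (ginv grp)); rewrite !ginvM => /gmulI/ginv_inj. Qed.

Lemma gmulV_eq1 x y : (gm (x^-1) y == e) = (y == x).
Proof.
apply/eqP/eqP => [xy|->]; last exact: gmulV.
by apply: (@gmulI (x^-1)); rewrite gmulV.
Qed.

Lemma gmulV_eq x y z : (gm (x^-1) y == z) = (y == gm x z).
Proof.
by apply/eqP/eqP => [<-|->]; rewrite ?gmulVKl ?gmulKl.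
Qed.

Lemma gpowD x m n : gpow grp x (m + n)%N = gm (gpow grp x m) (gpow grp x n).
Proof. by elim: m => [|m IHm]; rewrite ?gmul1//= IHm gmulA. Qed.

Section InfiniteOrder.
Variable a : G.
Hypothesis a_inf : forall n : nat, gpow grp a n.+1 <> e.

Lemma gpow_neq1 k : (0 < k)%N -> gpow grp a k <> e.
Proof. by case: k => // k _; exact: a_inf. Qed.

Lemma gpow_inj : injective (gpow grp a).
Proof.
move=> m n; wlog mn : m n / (m <= n)%N => [sym|].
  by case: (leqP m n) => [/sym//|/ltnW nm /esym/(sym _ _ nm)].
rewrite -(subnKC mn) gpowD -[X in X = _ -> _]gmulr1 => /gmulI /esym aE.
case: (n - m)%N aE => [|d] aE; first by rewrite addn0.
by have := a_inf aE.
Qed.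

Lemma gpow_neqV k i : (gpow grp a k.+1)^-1 <> gpow grp a i.
Proof.
move=> kiE; apply: (@gpow_neq1 (k.+1 + i)%N) => //.
by rewrite gpowD -kiE gmulrV.
Qed.
End InfiniteOrder.

Lemma subgroup_gpow (A : G -> Prop) (a : G) k : subgroup grp A -> A a -> A (gpow grp a k).
Proof. by case=> A1 AM _ Aa; elim: k => //= k IHk; exact: AM. Qed.

Lemma wprod_cat s t : wprod grp (s ++ t) = gm (wprod grp s) (wprod grp t).
Proof. by elim: s => [|u s IHs] /=; rewrite ?gmul1// IHs gmulA. Qed.

(** * Split functions: concatenation, existence, linearity *)

Section Split.
Context {R : realType}.
Implicit Types f fA fB F : G -> G -> R.

Lemma lact_mul g h (v : G -> R) x : lact grp (gm g h) v x = lact grp g (lact grp h v) x.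
Proof. by rewrite /lact ginvM gmulA. Qed.

Lemma splitw_cat fA fB s t x : splitw grp fA fB (s ++ t) x =
  splitw grp fA fB s x + lact grp (wprod grp s) (splitw grp fA fB t) x.
Proof.
elim: s x => [|u s IHs] x /=; first by rewrite add0r /lact ginv1 gmul1.
by rewrite lact_mul /lact IHs addrA.
Qed.

Lemma split_exists (A B : G -> Prop) fA fB : free_product grp A B ->
  exists F, is_split grp A B fA fB F.
Proof.
move=> AB.
have /choice [w wP] : forall g, exists s, [/\ reduced grp A B s, wprod grp s = g &
    forall t, reduced grp A B t -> wprod grp t = g -> t = s].
  by move=> g; have [s [? [? ?]]] := AB g; exists s.
exists (fun g => splitw grp fA fB (w g)) => s s_red.
by have [_ _ /(_ s s_red erefl) <-] := wP (wprod grp s).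
Qed.

(** Reduces linear independence to the study of a single split function. *)
Lemma is_split_sum (A B : G -> Prop) n (fA fB F : 'I_n -> G -> G -> R) (c : 'I_n -> R) :
  (forall i, is_split grp A B (fA i) (fB i) (F i)) ->
  is_split grp A B (fun g x => \sum_i c i * fA i g x) (fun g x => \sum_i c i * fB i g x)
    (fun g x => \sum_i c i * F i g x).
Proof.
move=> F_split s s_red; apply/funext => x.
under eq_bigr do rewrite F_split//.
elim: s {s_red} x => [|u s IHs] x /=; first by rewrite big1// => i _; rewrite mulr0.
rewrite /lact -IHs; case: ifP => _; rewrite -big_split/=;
  by under eq_bigr do rewrite mulrDr.
Qed.
End Split.

(** * The alternating quasicocycles supported on two powers of a *)

Section Bump.
Context {R : realType} {p : R}.
Hypothesis p_gt0 : 0 < p.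
Variable (a : G).

(* Alternating because [g.(delta_1 - delta_(g^-1)) = delta_g - delta_1]. *)
Definition power_bump (i : nat) (g : G) : G -> R :=
  if (g == gpow grp a i.+1) || (g^-1 == gpow grp a i.+1)
  then fun x => (x == e)%:R - (x == g)%:R else fun _ => 0.

Let C : R := 2 `^ p * (1 + 1).

Lemma power_bump_lple i g : lple (p := p) (power_bump i g) C.
Proof.
rewrite /power_bump; case: ifP => _.
  exact: (lpleB p_gt0 (lple_delta p_gt0 _) (lple_delta p_gt0 _)).
by apply: lple_le (lple0 p_gt0); rewrite mulr_ge0 ?powR_ge0.
Qed.

Lemma lple_lact g (v : G -> R) M : lple (p := p) v M -> lple (p := p) (lact grp g v) M.
Proof. by apply: lple_inj; exact: gmulI. Qed.

(** The defect is bounded because the values are. The support test is symmetric under inversion, so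
    in the alternating identity both terms are bumps or both vanish. *)
Lemma alt_quasicocycle_power_bump (A : G -> Prop) i : alt_quasicocycle grp p A (power_bump i).
Proof.
split=> [g _||g _ x].
- by apply/in_lpP; exists C; exact: power_bump_lple.
- exists (2 `^ p * (2 `^ p * (C + C) + C)) => g h _ _; apply/lpsum_leP.
  exact: (lpleB p_gt0 (lpleD p_gt0 (power_bump_lple i g) (lple_lact g (power_bump_lple i h)))
    (power_bump_lple i (gm g h))).
- rewrite /power_bump /lact ginvK orbC; case: ifP; rewrite ?addr0// => _.
  rewrite gmulV_eq1 gmulV_eq gmulrV; lra.
Qed.

Lemma alt_quasicocycle0 (B : G -> Prop) : alt_quasicocycle grp p B (fun _ _ => 0 : R).
Proof.
split=> [g _||g _ x]; last by rewrite /lact addr0.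
- by apply/in_lpP; exists 0; exact: lple0.
- exists 0 => g h _ _; apply/lpsum_leP.
  by apply: lple_eq (lple0 p_gt0) => x; rewrite /dcob /lact; lra.
Qed.
End Bump.
End Group.

(** * Reduced words in powers of a and the letter b *)

Section Words.
Context {G : countType} {grp : group_on G} {A B : G -> Prop}.
Local Notation gm := (gmul grp).
Local Notation e := (gone grp).
Local Notation "x ^-1" := (ginv grp x).
Hypothesis A_subgroup : subgroup grp A.
Hypothesis AB : free_product grp A B.
Variables a b : G.
Hypothesis Aa : A a.
Hypothesis a_inf : forall n : nat, gpow grp a n.+1 <> e.
Hypothesis Bb : B b.
Hypothesis b_neq1 : b <> e.

Definition abword (ks : seq nat) : seq (bool * G) :=
  flatten [seq [:: (true, gpow grp a k); (false, b)] | k <- ks].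

Lemma size_abword ks : size (abword ks) = (size ks).*2.
Proof. by elim: ks => //= k ks IHks; rewrite doubleS -IHks. Qed.

Lemma abword_rcons ks k :
  abword (rcons ks k) = abword ks ++ [:: (true, gpow grp a k); (false, b)].
Proof. by rewrite /abword map_rcons flatten_rcons. Qed.

Lemma wprod_abword_rcons ks k :
  wprod grp (abword (rcons ks k)) = gm (wprod grp (abword ks)) (gm (gpow grp a k) b).
Proof. by rewrite abword_rcons wprod_cat /= gmulr1. Qed.

Lemma reduced_power k : (0 < k)%N -> reduced grp A B [:: (true, gpow grp a k)].
Proof.
move=> k0; split=> // u; rewrite inE => /eqP -> /=.
by split; [exact: gpow_neq1|exact: subgroup_gpow].
Qed.

Lemma reduced_b : reduced grp A B [:: (false, b)].
Proof. by split=> // u; rewrite inE => /eqP ->. Qed.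

(** A nonempty [t] must start in A, as each block ends in b; the default [true] admits the empty
    [t]. The induction also carries this head condition. *)
Lemma reduced_abword_cat ks t : {in ks, forall k, 0 < k}%N ->
  reduced grp A B t -> head true (map fst t) -> reduced grp A B (abword ks ++ t).
Proof.
move=> + t_red t_head; suff: {in ks, forall k, 0 < k}%N ->
  reduced grp A B (abword ks ++ t) /\ head true (map fst (abword ks ++ t)).
  by move=> H /H[].
elim: ks => [|k ks IHks] ks_pos //=.
have [|[mem_red alt_red] hd] := IHks.
  by move=> j jks; apply: ks_pos; rewrite inE jks orbT.
have [k_red _] := reduced_power (ks_pos k (mem_head _ _)).
split=> //; split=> [u|/=].
  rewrite !inE => /or3P[/eqP->|/eqP->|/mem_red//]; last by [].
  by apply: k_red; rewrite mem_head.
rewrite -/(abword ks); case: (map _ _) hd alt_red => //= -[]//.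
Qed.

Lemma reduced_abword ks : {in ks, forall k, 0 < k}%N -> reduced grp A B (abword ks).
Proof.
by move=> ks_pos; rewrite -[abword ks]cats0; apply: reduced_abword_cat.
Qed.

Lemma reduced_wprod_inj s t : reduced grp A B s -> reduced grp A B t ->
  wprod grp s = wprod grp t -> s = t.
Proof.
move=> s_red t_red st; have [w [_ [_ w_uniq]]] := AB (wprod grp s).
by rewrite (w_uniq s)// (w_uniq t).
Qed.

(** * Comparing a split function with a bounded primitive *)

Section Cocycle.
Context {R : realType} {p : R}.
Hypothesis p_gt0 : 0 < p.
Variables (f F : G -> G -> R) (N : nat).
Hypothesis F_split : is_split grp A B f (fun _ _ => 0) F.
Hypothesis f_large : forall k, (N < k)%N -> f (gpow grp a k) =1 (fun _ => 0).

Lemma split_power k : (0 < k)%N -> F (gpow grp a k) =1 f (gpow grp a k).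
Proof.
move=> k0 x; have /(congr1 (@^~ x)) := F_split (reduced_power k0).
by rewrite /= gmulr1 /lact addr0.
Qed.

Lemma split_b : F b =1 (fun _ => 0).
Proof.
move=> x; have /(congr1 (@^~ x)) := F_split reduced_b.
by rewrite /= gmulr1 /lact addr0.
Qed.

Lemma split_abword_large ks : {in ks, forall k, N < k}%N ->
  F (wprod grp (abword ks)) =1 (fun _ => 0).
Proof.
move=> ks_large x; rewrite F_split; last first.
  by apply: reduced_abword => k /ks_large; case: k.
elim: ks ks_large x => [|k ks IHks] ks_large x //=.
rewrite /lact -/(abword ks) !add0r f_large ?add0r.
  by rewrite IHks// => j jks; apply: ks_large; rewrite inE jks orbT.
by apply: ks_large; rewrite mem_head.
Qed.

Section BoundedPrimitive.
Variables (beta : G -> G -> R) (M : R).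
Hypothesis beta_bound : forall g, lple (p := p) (beta g) M.
Hypothesis dbeta : forall g h x, dcob grp F g h x = dcob grp beta g h x.

(** The difference of [F] and [beta] is a cocycle, so its zero set is closed under products. *)
Lemma agree_mul g h : F g =1 beta g -> F h =1 beta h -> F (gm g h) =1 beta (gm g h).
Proof.
move=> Fg Fh x; have := dbeta g h x; rewrite /dcob /lact Fg Fh.
by move=> /addrI/oppr_inj.
Qed.

Hypothesis beta_power : forall k, F (gpow grp a k) =1 beta (gpow grp a k).

(* Otherwise [beta], evaluated at [a^k1 b ... a^kn b] with rapidly increasing
   exponents, is a sum of [n] almost disjoint translates of [beta b]. *)
Lemma beta_b_eq0 : beta b =1 (fun _ => 0).
Proof.
move=> x0; apply/eqP/negPn/negP => u_neq0.
set eps := `|beta b x0|; have eps0 : 0 < eps by rewrite normr_gt0.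
have eps20 : 0 < eps / 2 by lra.
(* The strict inequality leaves a margin at each of the finitely many points of [s], which absorbs
   the next translate. *)
suff large n : exists ks s, [/\ {in ks, forall k, N < k}%N, uniq s, size s = n &
    {in s, forall y, eps / 2 < `|beta (wprod grp (abword ks)) y|}].
  apply: (lple_no_large p_gt0 eps20 beta_bound) => n.
  have [ks [s [_ us sz large_s]]] := large n.
  by exists (wprod grp (abword ks)), s; split=> // y ys; exact/ltW/large_s.
elim: n => [|n [ks [s [ks_large us sz large_s]]]]; first by exists [::], [::].
set w := wprod grp (abword ks) in large_s.
(* [F] vanishes at w, b, a^k b and w a^k b, and equals [beta] at a^k; two coboundary identities give
   the formula. *)
have step k y : (N < k)%N -> beta (gm w (gm (gpow grp a k) b)) y =
    beta w y + beta b (gm ((gm w (gpow grp a k))^-1) y).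
  move=> Nk; have ak_b : wprod grp (abword [:: k]) = gm (gpow grp a k) b.
    by rewrite (wprod_abword_rcons [::]) gmul1.
  have ks_k_large : {in rcons ks k, forall k, N < k}%N.
    by move=> j; rewrite mem_rcons inE => /predU1P[->//|/ks_large].
  have Fab z : F (gm (gpow grp a k) b) z = 0.
    by rewrite -ak_b split_abword_large// => j; rewrite inE => /eqP ->.
  have := dbeta w (gm (gpow grp a k) b) y.
  have := dbeta (gpow grp a k) b (gm (w^-1) y).
  rewrite /dcob /lact !Fab split_b beta_power -wprod_abword_rcons.
  rewrite !split_abword_large// ginvM -gmulA; lra.
(* For large k, [beta w] is small at the new point w a^k x0, and the new translate of [beta b] is
   small on the old points. *)
have [k [Nk]] : exists k, [/\ (N < k)%N,
    `|beta w (gm (gm w (gpow grp a k)) x0)| < eps / 2 &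
    {in s, forall y, `|beta b (gm ((gm w (gpow grp a k))^-1) y)| < `|beta w y| - eps / 2}].
  near \oo => k; exists k; split.
  - by near: k; exact: nbhs_infty_gt.
  - near: k; apply: (lple_near0 p_gt0 _ (beta_bound w) eps20).
    by move=> i j /gmulIr/gmulI/(gpow_inj a_inf).
  - near: k; elim: s large_s {us sz} => [|y s IHs] large_s; first exact: nearW.
    have tail_near := IHs (fun z zs => large_s z (mem_behead (s := y :: s) zs)).
    have head_near : \forall k \near \oo,
        `|beta b (gm ((gm w (gpow grp a k))^-1) y)| < `|beta w y| - eps / 2.
      apply: (lple_near0 (q := fun k => gm ((gm w (gpow grp a k))^-1) y) p_gt0 _ (beta_bound b)).
        by move=> i j /gmulIr/ginv_inj/gmulI/(gpow_inj a_inf).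
      by rewrite subr_gt0 large_s// mem_head.
    apply: filterS2 head_near tail_near => k yk sk z; rewrite inE => /predU1P[->//|].
    exact: sk.
set y0 := gm _ x0 => small_y0 small_s.
exists (rcons ks k), (y0 :: s); split.
- by move=> j; rewrite mem_rcons inE => /predU1P[->//|/ks_large].
- rewrite /= us andbT; apply/negP => /large_s; lra.
- by rewrite /= sz.
- move=> y; rewrite wprod_abword_rcons step// inE => /predU1P[->|ys].
    rewrite gmulKl addrC; have := lerB_normD (beta b x0) (beta w y0).
    by rewrite -/eps; lra.
  have := small_s y ys; have := lerB_normD (beta w y) (beta b (gm ((gm w (gpow grp a k))^-1) y)).
  by lra.
Unshelve. all: by end_near. Qed.

Lemma agree_abword ks : F (wprod grp (abword ks)) =1 beta (wprod grp (abword ks)).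
Proof.
elim/last_ind: ks => [|ks k IHks]; first exact: (beta_power 0).
rewrite wprod_abword_rcons; do 2?apply: agree_mul => //.
by move=> x; rewrite split_b beta_b_eq0.
Qed.

(** Each syllable a^k contributes its value translated by the preceding prefix; the syllables b
    contribute 0. *)
Lemma split_abword_nseq n k x : (0 < k)%N ->
  F (wprod grp (abword (nseq n k))) x =
  \sum_(j < n) f (gpow grp a k) (gm (ginv grp (wprod grp (abword (nseq j k)))) x).
Proof.
move=> k0; rewrite F_split; last by apply: reduced_abword => j /nseqP[->].
elim: n => [|n IHn]; first by rewrite big_ord0.
have -> : nseq n.+1 k = rcons (nseq n k) k by rewrite -cats1 -(nseqD n 1) addn1.
rewrite big_ord_recr /= -IHn.
by rewrite abword_rcons splitw_cat /= /lact !addr0.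
Qed.

(* [beta] would take the value [c] at the [n] points [(a^k b)^i], [i < n]. *)
Lemma split_coef_eq0 (k : nat) (c : R) : (0 < k)%N ->
  (forall x, f (gpow grp a k) x = c * ((x == e)%:R - (x == gpow grp a k)%:R)) -> c = 0.
Proof.
move=> k0 fk; apply/eqP/negPn/negP => c_neq0.
have c0 : 0 < `|c| by rewrite normr_gt0.
pose y i := wprod grp (abword (nseq i k)).
have pos i : {in nseq i k, forall k, 0 < k}%N by move=> j /nseqP[->].
have y_inj : injective y.
  move=> i j /(reduced_wprod_inj (reduced_abword (pos i)) (reduced_abword (pos j))).
  by move=> /(congr1 size); rewrite !size_abword !size_nseq => /double_inj.
apply: (lple_no_large p_gt0 c0 beta_bound) => n; exists (y n), (map y (iota 0 n)).
split; rewrite ?map_inj_uniq ?iota_uniq ?size_map ?size_iota//.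
move=> _ /mapP[i + ->]; rewrite mem_iota add0n /= => i_lt_n.
rewrite -agree_abword split_abword_nseq//.
(* At y_i only the summand j = i survives: any other would need y_i = y_j or y_i = y_j a^k. *)
rewrite (bigD1 (Ordinal i_lt_n))//= big1 ?addr0 => [|j j_neq_i]; rewrite fk gmulV_eq1 gmulV_eq.
  rewrite eqxx (_ : (_ == _) = false) ?subr0 ?mulr1//.
  apply/eqP => /esym; rewrite -[RHS](gmulr1 grp) => /gmulI; exact: gpow_neq1.
rewrite (_ : (_ == _) = false); last first.
  by apply/eqP => /y_inj ij; move: j_neq_i; rewrite -val_eqE /= ij eqxx.
rewrite (_ : (_ == _) = false) ?subr0 ?mulr0//; apply/eqP => yij.
(* Two reduced words of the same element, one of even and one of odd length. *)
have /(congr1 size) : abword (nseq i k) = abword (nseq j k) ++ [:: (true, gpow grp a k)].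
  apply: reduced_wprod_inj; first exact: reduced_abword.
    by apply: reduced_abword_cat => //; exact: reduced_power.
  by rewrite wprod_cat /= gmulr1.
by rewrite size_cat !size_abword /=; lia.
Qed.
End BoundedPrimitive.

(* A bounded cocycle on the infinite cyclic group [<a>] is a coboundary: the
   cocycle [F - beta] agrees with [- beta] on large powers of [a], and it is the
   coboundary of the pointwise limit of [beta (a^k)] along an ultrafilter. *)
Lemma normalize_on_powers (beta : G -> G -> R) (M : R) :
  (exists C, lple (p := p) (f a) C) ->
  (forall g, lple (p := p) (beta g) M) ->
  (forall g h x, dcob grp F g h x = dcob grp beta g h x) ->
  exists beta' M', [/\ forall g, lple (p := p) (beta' g) M',
    forall g h x, dcob grp F g h x = dcob grp beta' g h x &
    forall k, F (gpow grp a k) =1 beta' (gpow grp a k)].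
Proof.
move=> [C faC] beta_bound dbeta.
have [U [UU ooU]] := @ultraFilterLemma nat \oo _.
have PU := @ultra_proper _ _ UU.
have /choice [v vlim] : forall x, exists l : R, (fun k => beta (gpow grp a k) x) @ U --> l.
  move=> x; apply: (@bounded_cvg_ultra _ _ _ (M `^ p^-1)) => k.
  have := ge0_ler_powR (r := p^-1) _ _ _ (lple_pointwise x (beta_bound (gpow grp a k))).
  rewrite -powRrM mulfV ?gt_eqF// powRr1//; apply;
    rewrite ?nnegrE ?powR_ge0 ?invr_ge0 ?(ltW p_gt0)//.
  exact: lple_ge0 (beta_bound e).
have vM : lple (p := p) v M.
  exact: (lple_cvg p_gt0 PU (fun k => beta_bound (gpow grp a k)) vlim).
(* The subtracted term is a coboundary, bounded since [v] is in l^p. *)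
pose beta' g x := beta g x - (v x - lact grp g v x).
have dbeta' g h x : dcob grp F g h x = dcob grp beta' g h x.
  by rewrite dbeta /dcob /beta' lact_mul /lact; lra.
exists beta'; eexists; split=> [g||].
- exact: (lpleB p_gt0 (beta_bound g) (lpleB p_gt0 vM (lple_lact grp g vM))).
- exact: dbeta'.
have a1 : a = gpow grp a 1 by rewrite /= gmulr1.
have F1 : F e =1 beta' e.
  by move=> x; have := dbeta' e e x; rewrite /dcob /lact ginv1 !gmul1; lra.
pose z g x := F g x - beta g x.
have zM g h y : z (gm g h) y = z g y + z h (gm (g^-1) y).
  by have := dbeta g h y; rewrite /dcob /z /lact; lra.
have zaM : lple (p := p) (z a) (2 `^ p * (C + M)).
  by apply: (lpleB p_gt0 _ (beta_bound a)); apply: lple_eq faC => x; rewrite a1 split_power.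
have Fa : F a =1 beta' a.
  move=> x; suff : z a x = v (gm (a^-1) x) - v x + 0 by rewrite /z /beta' /lact; lra.
  (* Expanding the cocycle [z] at a a^k = a^k a gives z(a) = a.beta(a^k) - beta(a^k) + a^k.z(a) for
     large k; the last term tends to 0 pointwise as z(a) is in l^p. *)
  pose zlim k := beta (gpow grp a k) (gm (a^-1) x) - beta (gpow grp a k) x +
    z a (gm ((gpow grp a k)^-1) x).
  apply: (@norm_cvg_unique _ _ (zlim @ U)).
    apply: cvg_near_cst; apply: ooU; near=> k.
    have Nk : (N < k)%N by near: k; exact: nbhs_infty_gt.
    have zk y : z (gpow grp a k) y = - beta (gpow grp a k) y.
      by rewrite /z split_power ?f_large ?sub0r//; case: (k) Nk.
    have : z (gm a (gpow grp a k)) x = z (gm (gpow grp a k) a) x.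
      by have := gpowD grp a k 1; rewrite addn1 -a1 => /= ->.
    by rewrite !zM !zk /zlim; lra.
  apply: cvgD; first by apply: cvgB; exact: vlim.
  apply/cvgr0Pnorm_lt => eps eps0; apply: ooU.
  apply: (lple_near0 (q := fun k => gm ((gpow grp a k)^-1) x) p_gt0 _ zaM eps0).
  by move=> i j /gmulIr/ginv_inj/(gpow_inj a_inf).
elim=> [|k IHk] //=; exact: (agree_mul dbeta').
Unshelve. all: by end_near. Qed.
End Cocycle.
End Words.

(** * Linear independence of the split classes *)

Lemma split_infinite_dim (R : realType) (p : R) (G : countType) (grp : group_on G)
    (A B : G -> Prop) (a b : G) : 0 < p ->
  subgroup grp A -> free_product grp A B -> B b -> b <> gone grp ->
  A a -> (forall n : nat, gpow grp a n.+1 <> gone grp) ->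
  split_classes_infinite_dim grp p A B.
Proof.
move=> p_gt0 A_subgroup AB Bb b_neq1 Aa a_inf n.
have /choice [F F_split] : forall i : 'I_n, exists F : G -> G -> R,
    is_split grp A B (power_bump grp a i) (fun _ _ => 0) F.
  by move=> i; exact: split_exists.
exists (fun i => power_bump grp a i), (fun _ _ _ => 0), F; split=> [i|c].
  by split; [exact: alt_quasicocycle_power_bump|exact: alt_quasicocycle0|].
move=> [beta [[_ [M beta_bound]] dbeta]] i.
pose f g x := \sum_i c i * power_bump grp a (nat_of_ord i) g x : R.
have f_power k x : (0 < k)%N -> f (gpow grp a k) x =
    \sum_(i < n | i.+1 == k) c i * ((x == gone grp)%:R - (x == gpow grp a k)%:R).
  move=> k0; rewrite [RHS]big_mkcond; apply: eq_bigr => j _; rewrite /power_bump.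
  (* No inverse of a positive power of a is a positive power, so only the first test of [power_bump]
     can succeed. *)
  have -> : (ginv grp (gpow grp a k) == gpow grp a j.+1) = false.
    by apply/eqP; case: k k0 => // k _; exact: gpow_neqV.
  rewrite (inj_eq (gpow_inj a_inf)) orbF eq_sym.
  by case: eqP; rewrite // mulr0.
have f_large k : (n < k)%N -> f (gpow grp a k) =1 (fun _ => 0).
  move=> nk x; rewrite f_power; last by case: k nk.
  by rewrite big1// => j /eqP jk; move: nk; rewrite -jk ltnNge ltn_ord.
have F0_split : is_split grp A B f (fun _ _ => 0) (fun g x => \sum_i c i * F i g x).
  have := is_split_sum c F_split; congr is_split.
  by apply/funext => g; apply/funext => x; rewrite big1// => j _; rewrite mulr0.
have [C faC] : exists C, lple (p := p) (f a) C.
  apply: lple_sum => // j; eexists; exact: power_bump_lple.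
have dF0 g h x : dcob grp (fun g x => \sum_i c i * F i g x) g h x = dcob grp beta g h x.
  rewrite -dbeta /dcob /lact -big_split -sumrB /=.
  by apply: eq_bigr => j _; rewrite mulrBr mulrDr.
have [beta' [M' [beta'_bound dbeta' beta'_power]]] :=
  normalize_on_powers A_subgroup Aa a_inf p_gt0 F0_split f_large (ex_intro _ C faC)
    (fun g => (lpsum_leP _ _).1 (beta_bound g I)) dF0.
apply: (split_coef_eq0 A_subgroup AB Aa a_inf Bb b_neq1 p_gt0 F0_split f_large
  beta'_bound dbeta' beta'_power (ltn0Sn i)) => x.
(* At a^(i+1) only the i-th bump is nonzero, which isolates [c i]. *)
by rewrite f_power// (big_pred1 i)// => j; rewrite eqSS.
Qed.

Unset Implicit Arguments.

Theorem theorem2p6 (R : realType) (G : countType) (grp : group_on G)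
    (A B : G -> Prop) :
  subgroup grp A -> subgroup grp B ->
  free_product grp A B ->
  (exists a, A a /\ a <> gone grp) ->
  (exists b, B b /\ b <> gone grp) ->
  (exists a, A a /\ forall n : nat, gpow grp a n.+1 <> gone grp) ->
  (forall p : R, 1 < p -> split_classes_infinite_dim grp p A B) /\
  (amenable_sub grp R A -> split_classes_infinite_dim grp (1 : R) A B).
Proof.
move=> A_subgroup _ AB _ [b [Bb b_neq1]] [a [Aa a_inf]].
have infinite_dim (p : R) (p_gt0 : 0 < p) :=
  split_infinite_dim p_gt0 A_subgroup AB Bb b_neq1 Aa a_inf.
by split=> [p p_gt1|_]; apply: infinite_dim => //; exact: lt_trans p_gt1.
Qed.
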